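(* Let $p$ be an odd prime. Every non-abelian metacyclic group of order $p^N$ belongs to exactly one of the following four types: (a) automatically split: every metacyclic structure of the group is automatically split. Such groups exist for every $N\geq 4$. (b) non-split metacyclic: every metacyclic structure of the group is non-splittable. Such groups exist for every $N\geq 6$. Their number is given by [Liedahl, Theorem 2]. (c) purely splittable: every metacyclic structure of the group is splittable (but not automatically split). Such groups exist for $N=3$ and for every $N\geq 5$. (d) mixed type: the group has at least one non-splittable and one splittable metacyclic structure. The splittable structures are then necessarily not automatically split. Such groups exist for every $N\geq 4$.
   Context: A metacyclic structure of a finite group $G$ is a cyclic normal subgroup $K\trianglelefteq G$ such that $G/K$ is also cyclic; $G$ is metacyclic if it has a metacyclic structure. A metacyclic factorization $G=SK$ is a metacyclic structure $K\trianglelefteq G$ together with a cyclic subgroup $S$ of $G$ such that $K$ and $S$ together generate $G$. It is called split if $S\cap K$ is trivial (i.e. $G=K\rtimes S$), otherwise non-split. A metacyclic factorization $G=SK$, and correspondingly the underlying metacyclic structure $K\trianglelefteq G$, is called - splittable if there is a cyclic subgroup $R$ of $G$ (possibly $R=S$) such that $G=RK$ is a split metacyclic factorization; - non-splittable if every metacyclic factorization $G=RK$ with the given $K$ (including $R=S$) is non-split; - automatically split if every metacyclic factorization $G=RK$ with the given $K$ (including $R=S$) is split. ''Such groups exist for $N$'' means that there exists a non-abelian metacyclic group of order $p^N$ of the given type. The sentence on the number of groups in (b) is an attribution to the earlier literature (Theorem 2 of a work of Liedahl); no formula is printed as part of the theorem. *)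

(* Defs.v *)
From HB Require Import structures.
From mathcomp Require Import all_boot all_fingroup all_solvable.

Set Implicit Arguments.
Unset Strict Implicit.
Unset Printing Implicit Defensive.

Local Open Scope group_scope.

Definition metacyclic_structure (gT : finGroupType) (G K : {group gT}) : bool :=
  [&& cyclic K, K <| G & cyclic (G / K)].

Definition metacyclic_factorization
    (gT : finGroupType) (G S K : {group gT}) : bool :=
  [&& metacyclic_structure G K, S \subset G, cyclic S & S <*> K == G].

Definition split_factorization
    (gT : finGroupType) (G S K : {group gT}) : bool :=
  metacyclic_factorization G S K && (S :&: K == 1).

(* The next three predicates are meant for K such that
   [metacyclic_structure G K] holds; for other K, which have no metacyclic
   factorization, the last two hold vacuously. *)
Definition splittable (gT : finGroupType) (G K : {group gT}) : bool :=
  [exists R : {group gT}, split_factorization G R K].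

Definition non_splittable (gT : finGroupType) (G K : {group gT}) : bool :=
  [forall R : {group gT},
     metacyclic_factorization G R K ==> ~~ split_factorization G R K].

Definition automatically_split (gT : finGroupType) (G K : {group gT}) : bool :=
  [forall R : {group gT},
     metacyclic_factorization G R K ==> split_factorization G R K].

Inductive metacyclic_type : Set :=
  | AutomaticallySplit
  | NonSplitMetacyclic
  | PurelySplittable
  | MixedType.

Definition of_type
    (gT : finGroupType) (G : {group gT}) (t : metacyclic_type) : bool :=
  match t with
  | AutomaticallySplit =>
      [forall (K : {group gT} | metacyclic_structure G K),
         automatically_split G K]
  | NonSplitMetacyclic =>
      [forall (K : {group gT} | metacyclic_structure G K), non_splittable G K]
  | PurelySplittable =>
      [forall (K : {group gT} | metacyclic_structure G K),
         splittable G K && ~~ automatically_split G K]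
  | MixedType =>
      [exists (K : {group gT} | metacyclic_structure G K), non_splittable G K]
      && [exists (K : {group gT} | metacyclic_structure G K), splittable G K]
  end.

Definition nonabelian_metacyclic_of_order
    (gT : finGroupType) (G : {group gT}) (n : nat) : bool :=
  [&& #|G| == n, ~~ abelian G & metacyclic G].

Definition type_exists (p N : nat) (t : metacyclic_type) : Prop :=
  exists (gT : finGroupType) (G : {group gT}),
    nonabelian_metacyclic_of_order G (p ^ N)%N && of_type G t.

(* Main.v *)
Require Import Defs.
From HB Require Import structures.
From mathcomp Require Import all_boot all_fingroup all_solvable.
From mathcomp Require Import ssralg finalg zmodp.
From mathcomp Require Import zify ring.

(** The whole theorem rests on two facts about a non-abelian metacyclic p-group
    G with p odd.

    First, if x normalises the p-cycle <[k]>, then (x k)^(p^n) differs from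
    x^(p^n) by a power k^(p^n u) with u prime to p (expg_mul_pexp): conjugation
    by x raises k to an exponent that is 1 modulo p, and the sum of the powers
    of such an exponent from 0 to p^n - 1 has p-valuation exactly n. Hence
    taking p^n-th powers on <[x]><[k]> is almost as simple as in an abelian
    group; in particular a structure K is automatically split if and only if
    the exponent of G divides #|G : K| (automatically_splitE). For a structure
    that splits at all, this says that #|K| <= #|G : K|.

    Second, all metacyclic structures of G have the same subgroup of order p,
    namely that of the nontrivial cyclic group G^`(1), which is contained in
    each of them. So a subgroup that meets one structure trivially meets all of
    them trivially (structure_trivI).

    Now let K be automatically split, with complement S, and let K' be any
    structure. Then S meets K' trivially, so #|K'| <= #|K|, the exponent of G
    divides #|G : K'|, and K' is automatically split too
    (automatically_split_all). Since every structure has a factorization, it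
    follows that each group is of exactly one of the four types.

    The examples of all types but the non-split one are semidirect products of
    <[k]>, of order p^m, by <[s]>, of order p^n, where s maps k to k^(1 + p^c):
    - automatically split: m <= n;
    - purely splittable: c <= n < m. With S = <[s]> and K = <[k]>, a structure K'
      satisfies either S K' = G, and S is a complement of K', or
      K K' = G, and then K' is so large that S is a complement of K' again;
    - mixed: n = 1, c = m - 1 and m > 2. Here <[s k^p]> is a structure that
      does not split.

    For the non-split type take k of order p^3 and b with b^(p^n) = k^(p^2) and
    k^b = k^(1 + p), n > 2. If R were a complement of a structure K', then
    either R <[k]> = G, and R would be a complement of <[k]>, which does not
    exist; or K' <[k]> = G, and K' would be so large that R has order at most p.
    But then R lies in the Frattini subgroup, so that K' = G would be cyclic. *)

Set Implicit Arguments.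
Unset Strict Implicit.
Unset Printing Implicit Defensive.

Local Open Scope group_scope.

(** * Powers in the presence of a cyclic normal subgroup *)

Lemma expn_1pmul_modp2 p t i :
  exists v, ((1 + p * t) ^ i = 1 + i * p * t + p ^ 2 * v)%N.
Proof.
elim: i => [|i [v IH]]; first by exists 0%N; rewrite expn0; lia.
exists (v + p * t * v + i * t * t)%N; rewrite expnS IH; ring.
Qed.

(** Modulo p^2 the sum is p + 'C(p, 2) p t, and 'C(p, 2) is a multiple of p
    because p is odd; for p = 2 the valuation of the sum can jump. *)
Lemma sum_expn_1pmul p t :
  odd p -> exists w, (\sum_(i < p) (1 + p * t) ^ i = p * (1 + p * w))%N.
Proof.
move=> p_odd.
have partial n : exists v,
  (\sum_(i < n) (1 + p * t) ^ i = n + 'C(n, 2) * p * t + p ^ 2 * v)%N.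
  elim: n => [|n [v IH]]; first exists 0%N.
    by rewrite big_ord0 bin0n /= !mul0n muln0.
  have [v' Ev'] := expn_1pmul_modp2 p t n.
  exists (v + v')%N; rewrite big_ord_recr /= IH Ev' binS bin1; ring.
(* The rest has to be divisible by p^2; p./2 comes from 'C(p, 2) = p * p./2. *)
have [v ->] := partial p; exists (p./2 * t + v)%N.
have -> : ('C(p, 2) = p * p./2)%N.
  by rewrite bin2odd //; have -> : (p.-1./2 = p./2)%N by lia.
ring.
Qed.

Lemma expn_prime_1pexp p c t :
  odd p -> 0 < c -> exists t', ((1 + p ^ c * t) ^ p = 1 + p ^ c.+1 * t')%N.
Proof.
case: c => // c p_odd _.
have [w Ew] := sum_expn_1pmul (p ^ c * t) p_odd.
exists (t * (1 + p * w))%N.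
have E : (p ^ c.+1 * t = p * (p ^ c * t))%N by rewrite expnS mulnA.
have pos : 0 < (1 + p ^ c.+1 * t) ^ p by rewrite expn_gt0.
by rewrite -(prednK pos) predn_exp {2}E Ew (expnS p c.+1); lia.
Qed.

(** Used to see that k |-> k^(1 + p^c) is an automorphism of order dividing
    p^n of a cyclic group of order p^m as soon as m <= c + n. *)
Lemma expn_1pexp p c n :
  odd p -> 0 < c -> exists t, ((1 + p ^ c) ^ (p ^ n) = 1 + p ^ (c + n) * t)%N.
Proof.
move=> p_odd c_gt0; elim: n => [|n [t IH]].
  by exists 1%N; rewrite expn0 expn1 addn0 muln1.
have [] := @expn_prime_1pexp p (c + n) t p_odd; first by rewrite addn_gt0 c_gt0.
by move=> t' E; exists t'; rewrite expnSr expnM IH E addnS.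
Qed.

Section PowersNormalCyclic.

Variables (gT : finGroupType) (p : nat).
Implicit Types x k : gT.

Lemma expg_mul_conj x k r j :
  k ^ x = k ^+ r -> (x * k) ^+ j = x ^+ j * k ^+ (\sum_(i < j) r ^ i).
Proof.
move=> kx; elim: j => [|j IH]; first by rewrite big_ord0 mulg1.
rewrite big_ord_recl expn0 (eq_bigr (fun i : 'I_j => r * r ^ i)%N); last first.
  by move=> i _; rewrite -expnS.
rewrite -big_distrr /= addnC addn1 expgSr IH !expgSr -!mulgA; congr (_ * _).
by rewrite !mulgA (conjgC (k ^+ _)) conjXg kx -expgM.
Qed.

Lemma conjXg_iter x k r j : k ^ x = k ^+ r -> k ^ (x ^+ j) = k ^+ (r ^ j).
Proof.
move=> kx; elim: j => [|j IH]; first by rewrite conjg1.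
by rewrite expgSr conjgM IH conjXg kx -expgM expnS.
Qed.

Hypothesis p_pr : prime p.

(** If k^x = k^r then r^(p^a) = 1 modulo p for p^a = #[x], and r^(p^a) = r
    modulo p by Fermat. *)
Lemma conjg_expg_1modp x k :
    p.-elt x -> p.-elt k -> x \in 'N(<[k]>) ->
  exists t, k ^ x = k ^+ (1 + p * t).
Proof.
move=> px pk nkx; have [->|ntk] := eqVneq k 1.
  by exists 0; rewrite conj1g expg1n.
have [r kx] : exists r, k ^ x = k ^+ r.
  by apply/cycleP; rewrite memJ_norm ?cycle_id.
exists (r %/ p); rewrite kx; congr (_ ^+ _).
have p_dvd_k : p %| #[k].
  have ntK : <[k]> != 1 by rewrite cycle_eq1.
  by have [] := pgroup_pdiv pk ntK.
have [a oa] := p_natP px.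
have : r ^ (p ^ a) == 1 %[mod #[k]].
  by rewrite -eq_expg_mod_order -(conjXg_iter _ kx) -oa expg_order conjg1 expg1.
move/eqP/(congr1 (modn^~ p)); rewrite !modn_dvdm // => rpa.
have iterF : forall b, r ^ (p ^ b) = r %[mod p].
  elim=> [|b IHb]; first by rewrite expn0 expn1.
  by rewrite expnSr expnM fermat_little.
have p_gt1 := prime_gt1 p_pr.
move: rpa; rewrite iterF (modn_small p_gt1) => r1.
by rewrite [LHS](divn_eq r p) r1 addnC mulnC.
Qed.

Hypothesis p_odd : odd p.

(** Taking p-th powers once multiplies the exponent of k by a sum of p powers
    of a number that is 1 modulo p, that is, by p times a number prime to p.
    The step can be repeated because every subgroup of <[k]> is
    characteristic, so that x^(p^n) normalises the cycle of the new power of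
    k. *)
Lemma expg_mul_pexp x k n :
    p.-elt x -> p.-elt k -> x \in 'N(<[k]>) ->
  exists2 u, coprime p u & (x * k) ^+ (p ^ n) = x ^+ (p ^ n) * k ^+ (p ^ n * u).
Proof.
move=> px pk nkx; elim: n => [|n [u co_pu IH]].
  by exists 1%N; rewrite ?coprimen1 ?expg1.
set y := x ^+ (p ^ n) in IH *; set h := k ^+ (p ^ n * u) in IH *.
have [t Et] : exists t, h ^ y = h ^+ (1 + p * t).
  apply: conjg_expg_1modp; rewrite ?p_eltX //.
  have: <[h]> \char <[k]> by rewrite cycle_subgroup_char ?cycleX.
  by move/char_norms/subsetP; apply; rewrite groupX.
have [w Ew] := sum_expn_1pmul t p_odd.
exists (u * (1 + p * w))%N.
  rewrite coprimeMr co_pu prime_coprime // dvdn_addl ?dvdn_mulr // dvdn1.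
  by rewrite neq_ltn prime_gt1 ?orbT.
rewrite expnSr expgM IH (expg_mul_conj _ Et) Ew -!expgM; congr (_ * _ ^+ _); lia.
Qed.

Lemma expg_mul_pexp_eq1 x k n :
    p.-elt x -> p.-elt k -> x \in 'N(<[k]>) -> x ^+ (p ^ n) = 1 ->
  ((x * k) ^+ (p ^ n) == 1) = (k ^+ (p ^ n) == 1).
Proof.
move=> px pk nkx xn; have [u co_pu ->] := expg_mul_pexp n px pk nkx.
rewrite xn mul1g -!order_dvdn Gauss_dvdl //.
by have [e ->] := p_natP pk; rewrite coprimeXl.
Qed.

End PowersNormalCyclic.

(** * Metacyclic structures and factorizations *)

Section Structures.

Variable gT : finGroupType.
Implicit Types (G K R S H : {group gT}).

Lemma metacyclic_structureP G K :
  reflect [/\ cyclic K, K <| G & cyclic (G / K)] (metacyclic_structure G K).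
Proof. exact: and3P. Qed.

Lemma structure_der1_sub G K : metacyclic_structure G K -> G^`(1) \subset K.
Proof.
case/metacyclic_structureP=> _ /andP[_ nKG] cycGK.
by rewrite der1_min ?cyclic_abelian.
Qed.

Lemma cyclic_quotient_joing G K H :
  K <| G -> H \subset G -> H <*> K == G -> cyclic H -> cyclic (G / K).
Proof.
move=> /andP[sKG nKG] sHG /eqP <- cycH.
by rewrite quotientYidr ?quotient_cyclic // (subset_trans sHG).
Qed.

Lemma joing_eq_quotient G K H :
  K <| G -> H \subset G -> (H <*> K == G) = (H / K == G / K).
Proof.
move=> nsKG sHG; have [sKG nKG] := andP nsKG.
have nKH := subset_trans sHG nKG.
apply/eqP/eqP=> [<- | eqHG]; first by rewrite quotientYidr.
apply/eqP; rewrite eqEsubset join_subG sHG sKG /= joingC norm_joinEr //.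
by rewrite -quotientSK // eqHG.
Qed.

Lemma structure_factorization G K :
  metacyclic_structure G K -> exists S, metacyclic_factorization G S K.
Proof.
move=> strK; have [cycK nsKG /cyclicP[xK defGK]] := metacyclic_structureP _ _ strK.
have [sKG nKG] := andP nsKG.
have : xK \in G / K by rewrite defGK cycle_id.
case/morphimP=> x nKx Gx defx; exists <[x]>%G.
rewrite /metacyclic_factorization strK cycle_subG Gx cycle_cyclic /=.
by rewrite joing_eq_quotient ?cycle_subG // quotient_cycle // -defx defGK.
Qed.

Lemma joing_cycle_mulr K s y : y \in K -> <[s * y]> <*> K = <[s]> <*> K.
Proof.
have sub x z : z \in K -> <[x * z]> <*> K \subset <[x]> <*> K.
  move=> Kz; rewrite join_subG joing_subr cycle_subG andbT groupM //.
    by rewrite -cycle_subG joing_subl.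
  exact: subsetP (joing_subr _ _) z Kz.
move=> Ky; apply/eqP; rewrite eqEsubset sub //=.
by rewrite -{1}[s](mulgK y) sub ?groupV.
Qed.

Lemma factorization_card G S K :
  metacyclic_factorization G S K -> #|S| = (#|G : K| * #|S :&: K|)%N.
Proof.
case/and4P=> /metacyclic_structureP[_ /andP[sKG nKG] _] sSG _ /eqP defG.
have := mul_cardG S K; rewrite -norm_joinEl ?(subset_trans sSG) // defG.
rewrite -(Lagrange sKG) -mulnA mulnC.
by move/eqP; rewrite eqn_pmul2l // => /eqP.
Qed.

(** By the cardinality formula, S is as small as #|G : K| only if it meets K
    trivially. *)
Lemma split_factorizationE G S K : metacyclic_factorization G S K ->
  split_factorization G S K = (#|S| <= #|G : K|).
Proof.
move=> facS; rewrite /split_factorization facS /= (factorization_card facS).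
by rewrite -{2}[#|G : K|]muln1 leq_pmul2l // -trivg_card_le1.
Qed.

(** The subgroups of a cyclic p-group form a chain. *)
Lemma cyclic_pgroup_join (p : nat) (A B Q : {group gT}) :
    p.-group Q -> cyclic Q -> A \subset Q -> B \subset Q -> A <*> B = Q ->
  A :=: Q \/ B :=: Q.
Proof.
move=> pQ cycQ sAQ sBQ defQ.
have [a oA] := p_natP (pgroupS sAQ pQ); have [b oB] := p_natP (pgroupS sBQ pQ).
have [le_ab | /ltnW le_ba] := leqP a b.
  have /joing_idPr <- : A \subset B.
    by rewrite -(cardSg_cyclic cycQ) // oA oB dvdn_exp2l.
  by right.
have /joing_idPl <- : B \subset A.
  by rewrite -(cardSg_cyclic cycQ) // oA oB dvdn_exp2l.
by left.
Qed.

End Structures.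

(** This is the chain condition for subgroups of the cyclic p-group G / K. *)
Lemma structure_join (p : nat) (gT : finGroupType) (G K H1 H2 : {group gT}) :
    p.-group G -> metacyclic_structure G K -> H1 <*> H2 = G ->
  H1 <*> K = G \/ H2 <*> K = G.
Proof.
move=> pG /metacyclic_structureP[_ nsKG cycGK] defG.
have [sKG nKG] := andP nsKG.
have [sH1 sH2] : H1 \subset G /\ H2 \subset G by rewrite -defG joing_subl joing_subr.
have: (H1 / K) <*> (H2 / K) = G / K.
  by rewrite -quotientY ?(subset_trans _ nKG) // defG.
have join_cases := cyclic_pgroup_join (quotient_pgroup _ pG) cycGK.
case/(join_cases _ _ (quotientS _ sH1) (quotientS _ sH2)) => /eqP;
  rewrite -joing_eq_quotient // => /eqP; tauto.
Qed.

Lemma metacyclic_structure_join (gT : finGroupType) (G K H : {group gT}) :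
  cyclic K -> K <| G -> cyclic H -> H <*> K = G -> metacyclic_structure G K.
Proof.
move=> cycK nsKG cycH defG; apply/metacyclic_structureP; split=> //.
by apply: cyclic_quotient_joing nsKG _ _ cycH; rewrite -defG ?joing_subl.
Qed.

Lemma structure_metacyclic (gT : finGroupType) (G K : {group gT}) :
  metacyclic_structure G K -> metacyclic G.
Proof. by move/metacyclic_structureP=> str; apply/metacyclicP; exists K. Qed.

Lemma der1_conj_expg (gT : finGroupType) (G : {group gT}) (k s : gT) q :
  k \in G -> s \in G -> k ^ s = k ^+ (1 + q) -> k ^+ q \in G^`(1).
Proof.
by move=> Gk Gs ks; rewrite -(mulKg k (k ^+ q)) -expgS -add1n -ks mem_commg.
Qed.

(** K1 covers G / K and its intersection with K contains G^`(1). *)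
Lemma leq_card_structure_join (gT : finGroupType) (G K1 K : {group gT}) :
    metacyclic_structure G K1 -> metacyclic_structure G K -> K1 <*> K = G ->
  #|G : K| * #|G^`(1)| <= #|K1|.
Proof.
move=> str1 str defG; have [cyc1 nsK1G _] := metacyclic_structureP _ _ str1.
have [sK1G _] := andP nsK1G.
have fac : metacyclic_factorization G K1 K.
  by rewrite /metacyclic_factorization str sK1G cyc1 defG eqxx.
rewrite (factorization_card fac) leq_pmul2l // subset_leq_card // subsetI.
by rewrite !structure_der1_sub.
Qed.

Section PGroup.

Variables (gT : finGroupType) (p : nat) (G : {group gT}).
Hypotheses (p_pr : prime p) (pG : p.-group G) (ncG : ~~ abelian G).
Implicit Types (K R S H : {group gT}).

(** The subgroup of order p of the cyclic p-group K2 is contained in its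
    nontrivial subgroup G^`(1), hence in K1. *)
Lemma structure_trivI K1 K2 H :
    metacyclic_structure G K1 -> metacyclic_structure G K2 ->
  H :&: K1 = 1 -> H :&: K2 = 1.
Proof.
move=> str1 str2 tiHK1; have [cyc2 /andP[sK2G _] _] := metacyclic_structureP _ _ str2.
have ntG' : G^`(1) != 1 by apply: contra ncG => /eqP/commG1P.
have sG'2 := structure_der1_sub str2.
have nt2 : K2 :!=: 1 by apply: contraNneq ntG' => K21; rewrite -subG1 -K21.
have p2 := pgroupS sK2G pG.
apply: TI_Ohm1; apply/trivgP; rewrite -tiHK1 setIS //.
apply: subset_trans (structure_der1_sub str1).
rewrite -(cardSg_cyclic cyc2) ?Ohm_sub // (Ohm1_cyclic_pgroup_prime cyc2 p2 nt2).
by have [] := pgroup_pdiv (pgroupS sG'2 p2) ntG'.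
Qed.

Hypothesis p_odd : odd p.

Lemma cycle_normal_in_structure K y :
  metacyclic_structure G K -> y \in K -> G \subset 'N(<[y]>).
Proof.
case/metacyclic_structureP=> /cyclicP[k ->] /andP[_ nKG] _ Ky.
apply: subset_trans nKG (char_norms _).
by rewrite cycle_subgroup_char // cycle_subG.
Qed.

Lemma structure_pexp K x y n :
    metacyclic_structure G K -> x \in G -> y \in K ->
  exists2 u, coprime p u & (x * y) ^+ (p ^ n) = x ^+ (p ^ n) * y ^+ (p ^ n * u).
Proof.
move=> strK Gx Ky.
have [_ /andP[/subsetP/(_ _ Ky) Gy _] _] := metacyclic_structureP _ _ strK.
apply: expg_mul_pexp; rewrite ?(mem_p_elt pG) //.
exact: (subsetP (cycle_normal_in_structure strK Ky)).
Qed.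

Lemma structure_pexp_eq1 K x y n :
    metacyclic_structure G K -> x \in G -> y \in K -> x ^+ (p ^ n) = 1 ->
  ((x * y) ^+ (p ^ n) == 1) = (y ^+ (p ^ n) == 1).
Proof.
move=> strK Gx Ky.
have [_ /andP[/subsetP/(_ _ Ky) Gy _] _] := metacyclic_structureP _ _ strK.
apply: expg_mul_pexp_eq1; rewrite ?(mem_p_elt pG) //.
exact: (subsetP (cycle_normal_in_structure strK Ky)).
Qed.

Lemma index_pexp K : exists n, #|G : K| = (p ^ n)%N.
Proof.
have: p.-nat #|G : K| by apply: pnat_dvd pG; apply: dvdn_indexg.
by case/p_natP=> n ->; exists n.
Qed.

(** With complement S, each element is a product of an element of S, whose
    order divides #|S| = #|G : K|, and an element of K. *)
Lemma split_exponent_dvd K S : split_factorization G S K ->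
  exponent K %| #|G : K| -> exponent G %| #|G : K|.
Proof.
case/andP=> facS tiSK; have [strK sSG cycS /eqP defG] := and4P facS.
have [_ /andP[_ nKG] _] := metacyclic_structureP _ _ strK.
have oS : #|S| = #|G : K|.
  by rewrite (factorization_card facS) (eqP tiSK) cards1 muln1.
have [n oGK] := index_pexp K; rewrite oGK in oS *; move/exponentP=> expK.
apply/exponentP=> x; rewrite -{1}defG norm_joinEl ?(subset_trans sSG) //.
case/mulsgP=> s y Ss Ky ->; apply/eqP.
have sn : s ^+ (p ^ n) = 1 by apply/eqP; rewrite -order_dvdn -oS order_dvdG.
by rewrite (structure_pexp_eq1 strK _ Ky sn) ?(subsetP sSG) ?expK.
Qed.

(** If K = <[k]> is automatically split and <[s]> is a complement, then <[s
    k]> is a complement too, so s and s k both have order p^n = #|G : K|; this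
    forces k^(p^n) = 1. Conversely, if the exponent divides #|G : K|, then no
    cyclic subgroup is large enough for a non-split factorization. *)
Lemma automatically_splitE K : metacyclic_structure G K ->
  automatically_split G K = (exponent G %| #|G : K|).
Proof.
move=> strK; have [cycK /andP[sKG nKG] _] := metacyclic_structureP _ _ strK.
apply/idP/idP=> [/forallP autK | expG]; last first.
  apply/forallP=> R; apply/implyP=> facR; rewrite split_factorizationE //.
  have [_ sRG /cyclicP[x defR] _] := and4P facR.
  rewrite dvdn_leq // (dvdn_trans _ expG) // defR dvdn_exponent //.
  by rewrite -cycle_subG -defR.
have [S facS] := structure_factorization strK.
have splitS := implyP (autK S) facS.
apply: split_exponent_dvd (splitS) _.
have [n oGK] := index_pexp K; rewrite oGK.
have order_gen R : metacyclic_factorization G R K -> #|R| = (p ^ n)%N.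
  move=> facR; rewrite (factorization_card facR) oGK.
  by have /andP[_ /eqP->] := implyP (autK R) facR; rewrite cards1 muln1.
have [_ sSG /cyclicP[s defS] /eqP defG] := and4P facS.
have Gs : s \in G by rewrite -cycle_subG -defS.
have [k defK] := cyclicP cycK.
have Gk : k \in G by rewrite (subsetP sKG) // defK cycle_id.
have Kk : k \in K by rewrite defK cycle_id.
have facSK : metacyclic_factorization G <[s * k]>%G K.
  rewrite /metacyclic_factorization strK cycle_subG groupM // cycle_cyclic /=.
  by rewrite joing_cycle_mulr // -defS defG.
have := order_gen _ facSK; rewrite /= -orderE => osk.
have: (s * k) ^+ (p ^ n) == 1 by rewrite -osk expg_order.
rewrite (structure_pexp_eq1 strK) //; last first.
  by rewrite -(order_gen _ facS) defS expg_order.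
by rewrite defK exponent_cycle order_dvdn.
Qed.

(** A complement S of K1 meets K2 trivially, so #|K2| <= #|K1| and #|G : K1|
    divides #|G : K2|: the exponent criterion passes from K1 to K2. *)
Lemma automatically_split_all K1 K2 :
    metacyclic_structure G K1 -> metacyclic_structure G K2 ->
  automatically_split G K1 -> automatically_split G K2.
Proof.
move=> str1 str2 aut1; rewrite automatically_splitE //.
have expG: exponent G %| #|G : K1| by rewrite -automatically_splitE.
apply: dvdn_trans expG _.
have [S facS] := structure_factorization str1.
have /andP[_ /eqP tiS1] := implyP (forallP aut1 S) facS.
have [_ sSG _ _] := and4P facS.
have oS : #|S| = #|G : K1| by rewrite (factorization_card facS) tiS1 cards1 muln1.
have [_ /andP[sK2G _] _] := metacyclic_structureP _ _ str2.
have : #|S| * #|K2| <= #|G|.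
  rewrite -TI_cardMg; last exact: structure_trivI str1 str2 tiS1.
  by rewrite subset_leq_card // mul_subG.
rewrite -(Lagrange sK2G) mulnC leq_pmul2l // oS.
have [[a ->] [b ->]] := (index_pexp K1, index_pexp K2).
by rewrite leq_exp2l ?prime_gt1 // => /dvdn_exp2l.
Qed.

(** The point is that a factorization exists, so that automatically split is
    not a vacuous condition. *)
Lemma automatically_split_not_non_splittable K : metacyclic_structure G K ->
  automatically_split G K -> ~~ non_splittable G K.
Proof.
move=> /structure_factorization[S facS] /forallP/(_ S)/implyP/(_ facS) splS.
by apply/forallPn; exists S; rewrite facS splS.
Qed.

Lemma non_splittableN K : metacyclic_structure G K ->
   non_splittable G K = ~~ splittable G K.
Proof.
move=> strK; apply/forallP/existsPn=> [H R | H R]; last by rewrite (H R) implybT.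
by have := H R; rewrite /split_factorization; case: metacyclic_factorization.
Qed.

Lemma unique_type : metacyclic G -> exists! t, of_type G t.
Proof.
case/metacyclicP=> K0 /metacyclic_structureP str0.
have [aut0 | naut0] := boolP (automatically_split G K0).
  have auto K : metacyclic_structure G K -> automatically_split G K.
    by move=> strK; apply: automatically_split_all str0 strK aut0.
  exists AutomaticallySplit; split=> [|[] //=].
  - by apply/forall_inP.
  - by move/forall_inP/(_ _ str0)=> /idPn[]; apply: automatically_split_not_non_splittable.
  - by move/forall_inP/(_ _ str0)=> /andP[_ /negP[]].
  case/andP=> /exists_inP[K strK nspl] _.
  by case/idPn: nspl; apply: automatically_split_not_non_splittable (auto K _).
have nauto K : metacyclic_structure G K -> ~~ automatically_split G K.
  by move=> strK; apply: contra naut0; apply: automatically_split_all strK str0.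
have nA : of_type G AutomaticallySplit -> False.
  by move/forall_inP/(_ _ str0); apply/negP.
have [allns | /forall_inPn[K1 str1 spl1]] :=
    boolP (of_type G NonSplitMetacyclic).
  have nospl K : metacyclic_structure G K -> ~~ splittable G K.
    by move=> strK; rewrite -non_splittableN ?(forall_inP allns).
  exists NonSplitMetacyclic; split=> [|[/nA|//||]] //.
    by move/forall_inP/(_ _ str0); rewrite (negPf (nospl _ str0)).
  by case/andP=> _ /exists_inP[K strK]; rewrite (negPf (nospl _ strK)).
have {}str1 : metacyclic_structure G K1 := str1.
rewrite non_splittableN // negbK in spl1.
have nN : of_type G NonSplitMetacyclic -> False.
  by move/forall_inP/(_ _ str1); rewrite non_splittableN // spl1.
have [allsp | ] := boolP (of_type G PurelySplittable).
  exists PurelySplittable; split=> [|[/nA|/nN|//|]] //.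
  case/andP=> /exists_inP[K strK ns] _; move/forall_inP: allsp => /(_ _ strK).
  by case/andP=> spl _; rewrite non_splittableN ?spl in ns.
move=> nP; have /forall_inPn[K2 str2 ns2] := nP.
have {}str2 : metacyclic_structure G K2 := str2.
rewrite nauto // andbT -non_splittableN // in ns2.
exists MixedType; split=> [|[/nA|/nN|h|]] //; last by rewrite h in nP.
by apply/andP; split; apply/exists_inP; [exists K2 | exists K1].
Qed.

Lemma mixed_not_automatically_split K :
    of_type G MixedType -> metacyclic_structure G K ->
  ~~ automatically_split G K.
Proof.
case/andP=> /exists_inP[K1 str1 ns1] _ strK; apply/negP=> autK.
case/idPn: ns1; apply: automatically_split_not_non_splittable => //.
exact: automatically_split_all strK str1 autK.
Qed.

End PGroup.

(** * Split extensions of cyclic groups *)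

(** The group comes from the general semidirect product of two cyclic groups
    behind the extremal groups; it is enough to exhibit the automorphism of
    'Z_q that multiplies by e. *)
Lemma exists_semidirect q n e :
    1 < q -> 1 < n -> coprime q e -> e ^ n = 1 %[mod q] ->
  exists (gT : finGroupType) (G : {group gT}) (k s : gT),
    [/\ <[k]> ><| <[s]> = G, #[k] = q, #[s] = n & k ^ s = k ^+ e].
Proof.
move=> q_gt1 n_gt1 co_qe en.
pose b : 'Z_q := Zp1.
have ob : #[b] = q by rewrite order_Zp1 Zp_cast.
have ex_aut : exists s, [/\ s \in Aut <[b]>, #[s] %| n & s b = b ^+ e].
  have Ue : (e%:R : 'Z_#[b])%R \is a GRing.unit by rewrite unitZpE ob.
  pose s := Zp_unitm (FinRing.unit _ Ue).
  have sA : s \in Aut <[b]> by rewrite Aut_aut.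
  have sb : s b = b ^+ e.
    have b_gt1 : 1 < #[b] by rewrite ob.
    by rewrite autE ?cycle_id //= /cyclem /= val_Zp_nat // expg_mod_order.
  exists s; split=> //; rewrite order_dvdn; apply/eqP.
  apply: (@eq_Aut _ <[b]>); rewrite ?groupX ?group1 // => c /cycleP[i ->].
  rewrite perm1 -(autmE (groupX n sA)) morphX ?cycle_id //= autmE; congr (_ ^+ _).
  have iter j : (s ^+ j) b = b ^+ (e ^ j).
    elim: j => [|j IH]; first by rewrite perm1.
    by rewrite expgSr permM IH -(autmE sA) morphX ?cycle_id //= autmE sb -expgM expnS.
  by rewrite iter -[RHS]expg1; apply/eqP; rewrite eq_expg_mod_order ob en.
have oG := Extremal.card e n_gt1 q_gt1.
have := isoGrp_hom (Extremal.Grp n_gt1 q_gt1 ex_aut).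
move: oG; move: (Extremal.gtype q n e) => gT oG.
case/existsP=> -[k s] /= /eqP[defG kq sn ks].
have nks : <[s]> \subset 'N(<[k]>) by rewrite norms_cycle ks mem_cycle.
have le_k : #[k] <= q by rewrite dvdn_leq ?order_dvdn ?kq // ltnW.
have le_s : #[s] <= n by rewrite dvdn_leq ?order_dvdn ?sn // ltnW.
rewrite norm_joinEr // in defG.
have le_G : #|<[k]> * <[s]>| <= #[k] * #[s].
  by rewrite /order mul_cardG leq_pmulr ?cardG_gt0.
rewrite defG oG in le_G.
have [ok os] : #[k] = q /\ #[s] = n by nia.
exists gT, [set: gT]%G, k, s; split=> //.
rewrite sdprodE //; apply: cardMg_TI.
by rewrite defG oG -!orderE ok os mulnC.
Qed.

Lemma exists_pgroup_semidirect p m n c :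
    prime p -> odd p -> 0 < m -> 0 < n -> 0 < c -> m <= c + n ->
  exists (gT : finGroupType) (G : {group gT}) (k s : gT),
    [/\ <[k]> ><| <[s]> = G, #[k] = (p ^ m)%N, #[s] = (p ^ n)%N
      & k ^ s = k ^+ (1 + p ^ c)].
Proof.
move=> p_pr p_odd m_gt0 n_gt0 c_gt0 le_m; have p_gt1 := prime_gt1 p_pr.
have gt1 d : 0 < d -> 1 < p ^ d by move=> d_gt0; rewrite -(exp1n d) ltn_exp2r.
apply: exists_semidirect; rewrite ?gt1 //.
  rewrite coprimeXl // prime_coprime // dvdn_addl ?dvdn_exp // dvdn1.
  by rewrite neq_ltn p_gt1 orbT.
have [t ->] := expn_1pexp n p_odd c_gt0.
by rewrite -(subnKC le_m) expnD -mulnA addnC mulnC modnMDl.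
Qed.

Section Semidirect.

Variables (gT : finGroupType) (G : {group gT}) (p m n c : nat) (k s : gT).
Hypotheses (p_pr : prime p) (p_odd : odd p) (defG : <[k]> ><| <[s]> = G).
Hypotheses (ok : #[k] = (p ^ m)%N) (os : #[s] = (p ^ n)%N).
Hypotheses (ks : k ^ s = k ^+ (1 + p ^ c)) (lt_cm : c < m).

Let K := <[k]>%G.
Let S := <[s]>%G.

Lemma semidirect_card : #|G| = (p ^ (m + n))%N.
Proof. by rewrite -(sdprod_card defG) -!orderE ok os expnD. Qed.

Lemma semidirect_pgroup : p.-group G.
Proof. by rewrite /pgroup semidirect_card pnatX pnat_id. Qed.

Lemma semidirect_index : #|G : K| = (p ^ n)%N.
Proof. by rewrite -(index_sdprod defG) -orderE os. Qed.

Lemma semidirect_join : S <*> K = G.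
Proof.
by rewrite joingC; case/sdprodP: defG => _ <- nKS _; rewrite norm_joinEr.
Qed.

Lemma semidirect_trivI : S :&: K = 1.
Proof. by rewrite setIC; case/sdprodP: defG. Qed.

Lemma semidirect_mem : k \in G /\ s \in G.
Proof. by rewrite -!cycle_subG -semidirect_join joing_subl joing_subr. Qed.

Lemma semidirect_structure : metacyclic_structure G K.
Proof.
apply: (@metacyclic_structure_join _ _ _ S); rewrite ?cycle_cyclic ?semidirect_join //.
by case/sdprod_context: defG.
Qed.

Lemma semidirect_split : split_factorization G S K.
Proof.
rewrite /split_factorization /metacyclic_factorization semidirect_structure.
by rewrite semidirect_trivI -semidirect_join joing_subl cycle_cyclic !eqxx.
Qed.

Lemma semidirect_der1 : k ^+ (p ^ c) \in G^`(1).
Proof. by have [Gk Gs] := semidirect_mem; apply: der1_conj_expg Gk Gs ks. Qed.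

Lemma semidirect_card_der1 : p ^ (m - c) <= #|G^`(1)|.
Proof.
rewrite -(orderXexp c ok) orderE subset_leq_card //.
by rewrite cycle_subG semidirect_der1.
Qed.

Lemma semidirect_nonabelian : ~~ abelian G.
Proof.
apply/negP=> /commG1P G'1; have := semidirect_card_der1.
rewrite derg1 G'1 cards1 leqNgt -(expn0 p) ltn_exp2l ?prime_gt1 ?subn_gt0 //.
by rewrite lt_cm.
Qed.

Lemma semidirect_nonabelian_metacyclic N : N = (m + n)%N ->
  nonabelian_metacyclic_of_order G (p ^ N).
Proof.
move=> ->; rewrite /nonabelian_metacyclic_of_order semidirect_card eqxx.
by rewrite semidirect_nonabelian (structure_metacyclic semidirect_structure).
Qed.

Lemma semidirect_automatically_split : m <= n -> of_type G AutomaticallySplit.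
Proof.
move=> le_mn; apply/forall_inP=> K1 str1.
have strK := semidirect_structure; have pG := semidirect_pgroup.
have ncG := semidirect_nonabelian.
apply: (automatically_split_all p_pr pG ncG p_odd strK str1).
rewrite (automatically_splitE p_pr pG) //.
apply: (split_exponent_dvd p_pr pG p_odd semidirect_split).
by rewrite semidirect_index exponent_cycle ok dvdn_exp2l.
Qed.

Lemma semidirect_not_automatically_split K1 :
   n < m -> metacyclic_structure G K1 -> ~~ automatically_split G K1.
Proof.
move=> lt_nm str1; have strK := semidirect_structure; have pG := semidirect_pgroup.
have ncG := semidirect_nonabelian.
apply/negP=> /(automatically_split_all p_pr pG ncG p_odd str1 strK).
rewrite (automatically_splitE p_pr pG) // semidirect_index.
have [Gk _] := semidirect_mem.
move/(dvdn_trans (dvdn_exponent Gk)); rewrite ok dvdn_Pexp2l ?prime_gt1 //.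
by rewrite leqNgt lt_nm.
Qed.

(** The complement S = <[s]> of K = <[k]> is a complement of every structure
    K1. It meets K1 trivially, and if S K1 is not already G, then K1 K = G and
    #|K1| >= #|G : K| #|G^`(1)| >= p^n p^(m - c) >= p^m, so that S K1 has at
    least #|G| elements. *)
Lemma semidirect_purely_splittable :
  c <= n -> n < m -> of_type G PurelySplittable.
Proof.
move=> le_cn lt_nm; apply/forall_inP=> K1 str1.
rewrite semidirect_not_automatically_split // andbT.
have strK := semidirect_structure; have pG := semidirect_pgroup.
have ncG := semidirect_nonabelian.
have [Gk Gs] := semidirect_mem.
have [_ /andP[sK1G nK1G] _] := metacyclic_structureP _ _ str1.
have nK1S : S \subset 'N(K1) by rewrite cycle_subG (subsetP nK1G).
have tiS1 : S :&: K1 = 1.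
  exact: (structure_trivI pG ncG strK str1 semidirect_trivI).
apply/existsP; exists S; rewrite /split_factorization /metacyclic_factorization.
rewrite str1 cycle_subG Gs cycle_cyclic tiS1 eqxx andbT /=.
have [-> //|defG1] := structure_join pG str1 semidirect_join.
have sS1G : S * K1 \subset G by rewrite mul_subG // cycle_subG.
rewrite norm_joinEl // eqEcard sS1G TI_cardMg //= semidirect_card -orderE os.
rewrite addnC expnD leq_pmul2l ?expn_gt0 ?prime_gt0 //.
rewrite joingC in defG1.
apply: leq_trans (leq_card_structure_join str1 strK defG1).
rewrite semidirect_index; apply: leq_trans (leq_mul (leqnn _) semidirect_card_der1).
by rewrite -expnD leq_exp2l ?prime_gt1 //; clear -le_cn lt_nm; lia.
Qed.

(** The group has a cyclic subgroup of index p. The structure that does not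
    split is <[h]> with h = s k^p. It contains G^`(1) = <[k^(p^c)]>, so it is
    normal, and h k^(-p) = s shows that it generates G together with k. A
    complement of <[h]> would be trivial on K too, so its order would be at
    most #|G : K| = p; but h has order at most p^c, so its index in G is at
    least p^2. *)
Lemma semidirect_mixed : n = 1%N -> c = m.-1 -> 2 < m -> of_type G MixedType.
Proof.
move=> n1 cE m_gt2; have strK := semidirect_structure.
have pG := semidirect_pgroup; have ncG := semidirect_nonabelian.
have [Gk Gs] := semidirect_mem.
have cSm : c.+1 = m by rewrite cE (ltn_predK m_gt2).
have [c_gt0 pc_gt0] : 0 < c /\ 0 < c.-1 by clear -cSm m_gt2; lia.
have Kkp : k ^+ p \in K by rewrite mem_cycle.
pose h := s * k ^+ p.
have Gh : h \in G by rewrite groupM ?groupX.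
have hX e : 0 < e -> exists2 u, coprime p u & h ^+ (p ^ e) = k ^+ (p ^ e.+1 * u).
  move=> e_gt0; have [u co_pu ->] := structure_pexp p_pr pG p_odd e strK Gs Kkp.
  exists u => //; rewrite -expgM mulnA -expnS.
  suff /eqP-> : s ^+ (p ^ e) == 1 by rewrite mul1g.
  by rewrite -order_dvdn os n1 dvdn_exp2l.
have oz : #[k ^+ (p ^ c)] = p by rewrite (orderXexp c ok) -cSm subSnn.
(* h^(p^(c - 1)) is a power of k^(p^c) with exponent prime to p: here m > 2 is
   needed for s^(p^(c - 1)) = 1. *)
have h_kq : k ^+ (p ^ c) \in <[h]>.
  have [u co_pu hu] := hX _ pc_gt0.
  have /eqP genz : generator <[k ^+ (p ^ c)]> ((k ^+ (p ^ c)) ^+ u).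
    by rewrite generator_coprime oz.
  rewrite -cycle_subG genz -expgM; rewrite prednK // in hu.
  by rewrite -hu cycleX.
have nsHG : <[h]>%G <| G.
  rewrite /normal cycle_subG Gh -semidirect_join join_subG !norms_cycle.
  have kps : (k ^+ p) ^ s = k ^+ p * (k ^+ (p ^ c)) ^+ p.
    by rewrite conjXg ks -!expgM -expgD mulnDl mul1n.
  (* s and k commute up to k^(p^c), which is in <[h]>. *)
  have sk : s ^ k = s * (k ^+ (p ^ c))^-1.
    have -> : s ^ k = s * (k^-1) ^ s * k by rewrite !conjgE !mulgA mulgV mul1g.
    by rewrite conjVg ks expgD expg1 invMg !mulgA mulgKV.
  have [hs hk] : h ^ s = h * (k ^+ (p ^ c)) ^+ p /\ h ^ k = h * (k ^+ (p ^ c))^-1.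
    rewrite !conjMg kps sk conjXg (conjgE s s) (conjgE k k) !mulKg.
    rewrite -!mulgA; split=> //; congr (_ * _).
    by symmetry; apply: commuteV; apply: commuteX2.
  by rewrite hs hk !(groupMl _ (cycle_id h)) groupV h_kq groupX.
have defHK : <[h]> <*> K = G.
  by rewrite (joing_cycle_mulr _ Kkp) semidirect_join.
have defKH : K <*> <[h]> = G by rewrite joingC.
have strH := metacyclic_structure_join (cycle_cyclic _) nsHG (cycle_cyclic _) defKH.
apply/andP; split; apply/exists_inP; last first.
  by exists K => //; apply/existsP; exists S; apply: semidirect_split.
exists <[h]>%G => //; rewrite non_splittableN //; apply/existsPn=> R.
apply/negP=> /andP[facR /eqP tiRH].
have := factorization_card facR; rewrite tiRH cards1 muln1 => oR.
have tiRK := structure_trivI pG ncG strH strK tiRH.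
have [_ sRG _ _] := and4P facR.
have : #|R| * #|K| <= #|G|.
  by rewrite -TI_cardMg // subset_leq_card // mul_subG // cycle_subG.
have oh : #[h] <= p ^ c.
  rewrite dvdn_leq ?expn_gt0 ?prime_gt0 // order_dvdn.
  have [u _ ->] := hX _ c_gt0.
  by rewrite cSm expgM -ok expg_order expg1n.
have := Lagrange (normal_sub nsHG); rewrite -oR -orderE => oG.
rewrite -[#|K|]orderE ok -oG mulnC leq_pmul2r // => /leq_trans/(_ oh).
by rewrite leq_exp2l ?prime_gt1 // leqNgt lt_cm.
Qed.

End Semidirect.

(** * A group all of whose metacyclic structures are non-splittable *)

(** In the semidirect product of <[k]>, of order p^3, by <[b]>, of order p^(n
    + 1), the element b^(p^n) k^(-p^2) is central of order p and generates a
    subgroup that meets <[k]> trivially; divide by it. *)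
Lemma exists_amalgam p n : prime p -> odd p -> 2 < n ->
  exists (gT : finGroupType) (G : {group gT}) (k b : gT),
    [/\ <[b]> <*> <[k]> = G, #|G| = (p ^ (n + 3))%N, #[k] = (p ^ 3)%N,
        k ^ b = k ^+ (1 + p) & b ^+ (p ^ n) = k ^+ (p ^ 2)].
Proof.
move=> p_pr p_odd n_gt2; have p_gt1 := prime_gt1 p_pr.
have [||||gT [H [k [b [defH ok ob kb]]]]] :=
  @exists_pgroup_semidirect p 3 n.+1 1 p_pr p_odd => //.
  by clear -n_gt2; lia.
rewrite expn1 in kb; have [Hk Hb] := semidirect_mem defH.
have [_ _ _ tiKB] := sdprodP defH.
have ckb : commute (k ^+ (p ^ 2)) b.
  apply/commgP/conjg_fixP; rewrite conjXg kb -expgM mulnC mulnDr muln1 -expnSr.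
  by rewrite expgD -ok expg_order mulg1.
have cbk : commute k (b ^+ (p ^ n)).
  apply/commgP/conjg_fixP; rewrite (conjXg_iter _ kb) -[in (1 + p)%N](expn1 p).
  have [t ->] := @expn_1pexp p 1 n p_odd isT.
  rewrite expgD expg1 (_ : k ^+ _ = 1) ?mulg1 //; apply/eqP.
  by rewrite -order_dvdn ok dvdn_mulr // dvdn_exp2l // add1n ltnW.
pose z := b ^+ (p ^ n) * (k ^+ (p ^ 2))^-1.
have zp : z ^+ p = 1.
  rewrite expgMn; last by apply: commuteV; apply: commute_sym; apply: commuteX.
  by rewrite expgVn -!expgM -!expnSr -ok -ob !expg_order invg1 mulg1.
have notKz : z \notin <[k]>.
  rewrite groupMr ?groupV ?mem_cycle //; apply/negP=> Kbn.
  have : b ^+ (p ^ n) \in <[k]> :&: <[b]> by rewrite inE Kbn mem_cycle.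
  rewrite tiKB inE -order_dvdn ob dvdn_Pexp2l //.
  by rewrite ltnn.
have oz : #[z] = p.
  by apply: nt_prime_order => //; apply: contraNneq notKz => ->.
have tiZK : <[z]> :&: <[k]> = 1.
  by apply: prime_TIg; rewrite -?orderE ?oz // cycle_subG.
have Hz : z \in H by rewrite groupM ?groupV ?groupX.
have nZk : k \in 'N(<[z]>).
  apply/(subsetP (cent_sub _)); rewrite cent_cycle; apply/cent1P.
  by apply: commuteM => //; apply: commuteV; apply: commuteX.
have nZb : b \in 'N(<[z]>).
  apply/(subsetP (cent_sub _)); rewrite cent_cycle; apply/cent1P.
  by apply: commuteM; [apply: commuteX | apply: commuteV; apply: commute_sym].
have defH' : <[b]> <*> <[k]> = H := semidirect_join defH.
have nZH : H \subset 'N(<[z]>) by rewrite -defH' join_subG !cycle_subG nZb.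
exists _, (H / <[z]>)%G, (coset <[z]> k), (coset <[z]> b).
split.
- by rewrite /= -defH' quotientY ?cycle_subG // !quotient_cycle.
- rewrite card_quotient // -divgS ?cycle_subG //= -orderE oz.
  rewrite (semidirect_card defH ok ob) addnS expnSr mulnK ?prime_gt0 //.
  by rewrite addnC.
- have nZK : <[k]> \subset 'N(<[z]>) by rewrite cycle_subG.
  by rewrite orderE -quotient_cycle // -(card_isog (quotient_isog nZK tiZK)).
- by rewrite -morphJ // kb morphX.
rewrite -!morphX //; apply/rcoset_kercosetP; rewrite ?groupX //.
by rewrite mem_rcoset cycle_id.
Qed.

Section Amalgam.

Variables (gT : finGroupType) (G : {group gT}) (p n : nat) (k b : gT).
Hypotheses (p_pr : prime p) (p_odd : odd p) (n_gt2 : 2 < n).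
Hypotheses (defG : <[b]> <*> <[k]> = G) (oG : #|G| = (p ^ (n + 3))%N).
Hypotheses (ok : #[k] = (p ^ 3)%N) (kb : k ^ b = k ^+ (1 + p)).
Hypothesis bk : b ^+ (p ^ n) = k ^+ (p ^ 2).

Let K := <[k]>%G.

Lemma amalgam_pgroup : p.-group G.
Proof. by rewrite /pgroup oG pnatX pnat_id. Qed.

Lemma amalgam_mem : k \in G /\ b \in G.
Proof. by rewrite -!cycle_subG -defG joing_subl joing_subr. Qed.

Lemma amalgam_structure : metacyclic_structure G K.
Proof.
apply: (@metacyclic_structure_join _ _ _ <[b]>%G); rewrite ?cycle_cyclic //.
rewrite /normal -defG joing_subr join_subG normG norms_cycle kb mem_cycle.
by rewrite andbT.
Qed.

Lemma amalgam_index : #|G : K| = (p ^ n)%N.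
Proof.
have [Gk _] := amalgam_mem.
have sKG : K \subset G by rewrite cycle_subG.
by rewrite -divgS // oG -orderE ok expnD mulnK // expn_gt0 prime_gt0.
Qed.

Lemma amalgam_card_der1 : p ^ 2 <= #|G^`(1)|.
Proof.
have [Gk Gb] := amalgam_mem.
have ok' : #[k ^+ p] = (p ^ 2)%N by rewrite -[in k ^+ p](expn1 p) (orderXexp _ ok).
rewrite -ok' orderE subset_leq_card // cycle_subG.
exact: der1_conj_expg Gk Gb kb.
Qed.

Lemma amalgam_nonabelian : ~~ abelian G.
Proof.
apply/negP=> /commG1P G'1; have := amalgam_card_der1.
by rewrite derg1 G'1 cards1 leqNgt -(expn0 p) ltn_exp2l ?prime_gt1.
Qed.

(** Let R = <[x]> be a complement of K1, and K = <[k]>. Either R or K1 covers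
    G / K. If R does, then R is a complement of K and x has order p^n; as
    k^(p^n) = 1, this gives 1 = x^(p^n) = b^(j p^n) = k^(j p^2) for x in b^j
    K. So p divides j, and then already x^(p^(n - 1)) lies in R :&: K, a
    contradiction. If K1 does, then #|K1| >= p^n p^2, so x^p = 1; this forces
    x = b^j k^i with p dividing both i and j, so x is in the Frattini subgroup
    and K1 = G. *)
Lemma amalgam_non_split : of_type G NonSplitMetacyclic.
Proof.
apply/forall_inP=> K1 str1; rewrite non_splittableN //; apply/existsPn=> R.
apply/negP=> /andP[facR /eqP tiR1].
have p_gt1 := prime_gt1 p_pr; have p_gt0 := prime_gt0 p_pr.
have strK := amalgam_structure; have pG := amalgam_pgroup.
have ncG := amalgam_nonabelian; have [Gk Gb] := amalgam_mem.
have oGK := amalgam_index.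
have [_ /andP[sKG nKG] _] := metacyclic_structureP _ _ strK.
have [_ /andP[sK1G _] _] := metacyclic_structureP _ _ str1.
have [_ sRG cycR /eqP defGR] := and4P facR.
have [x defR] := cyclicP cycR.
have Gx : x \in G by rewrite -cycle_subG -defR.
have [j [i defx]] : exists j i, x = b ^+ j * k ^+ i.
  have nKB : <[b]> \subset 'N(K) by rewrite cycle_subG (subsetP nKG).
  move: Gx; rewrite -defG norm_joinEl // => /mulsgP[_ _ /cycleP[j ->] /cycleP[i ->] ->].
  by exists j, i.
have Kki : k ^+ i \in K by rewrite mem_cycle.
have xX e : exists2 u, coprime p u &
    x ^+ (p ^ e) = b ^+ (j * p ^ e) * k ^+ (i * (p ^ e * u)).
  have Gbj : b ^+ j \in G by rewrite groupX.
  have [u co_pu E] := structure_pexp p_pr pG p_odd e strK Gbj Kki.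
  by exists u; rewrite // defx E -!expgM.
have [defRK|] := structure_join pG strK defGR.
  have tiRK := structure_trivI pG ncG str1 strK tiR1.
  have facRK : metacyclic_factorization G R K.
    by rewrite /metacyclic_factorization strK sRG cycR defRK eqxx.
  have := factorization_card facRK; rewrite tiRK cards1 muln1 oGK defR -orderE => ox.
  have p_dvd_j : p %| j.
    have [u _] := xX n; rewrite -ox expg_order ox.
    have -> : k ^+ (i * (p ^ n * u)) = 1.
      apply/eqP; rewrite -order_dvdn ok dvdn_mull // dvdn_mulr //.
      by rewrite dvdn_exp2l.
    rewrite mulg1 mulnC expgM bk -expgM => /esym/eqP.
    by rewrite -order_dvdn ok expnS mulnC dvdn_pmul2l // expn_gt0 p_gt0.
  have [u _ E] := xX n.-1.
  have : x ^+ (p ^ n.-1) \in R :&: K.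
    rewrite inE defR mem_cycle E groupM ?mem_cycle //.
    have [j' ->] := dvdnP p_dvd_j.
    by rewrite -mulnA -expnS (ltn_predK n_gt2) mulnC expgM bk -expgM mem_cycle.
  rewrite tiRK inE -order_dvdn ox dvdn_Pexp2l // => le_n.
  by clear -n_gt2 le_n; lia.
move=> defG1; have le_1 := leq_card_structure_join str1 strK defG1.
have {}le_1 : p ^ (n + 2) <= #|K1|.
  apply: leq_trans le_1; rewrite oGK expnD.
  exact: leq_mul (leqnn _) amalgam_card_der1.
have xp : x ^+ p = 1.
  have [e ox] := p_natP (mem_p_elt pG Gx : p.-nat #[x]).
  have oR := factorization_card facR; rewrite tiR1 cards1 muln1 defR in oR.
  have := Lagrange sK1G; rewrite -oR -orderE ox oG => oK1R.
  have le_e : e <= 1.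
    have := leq_mul le_1 (leqnn (p ^ e)); rewrite oK1R -expnD leq_exp2l //.
    by clear; lia.
  by apply/eqP; rewrite -order_dvdn ox -[p in _ %| p]expn1 dvdn_exp2l.
have [u co_pu] := xX 1%N; rewrite expn1 xp => /esym E.
have b_dvd e : b ^+ e \in K -> p ^ n %| e.
  move=> Kbe; have nKb : b \in 'N(K) by rewrite (subsetP nKG).
  have <- : #[coset K b] = (p ^ n)%N.
    have /eqP := defG; rewrite joing_eq_quotient ?cycle_subG //; last first.
      by rewrite /normal sKG.
    by rewrite quotient_cycle // orderE => /eqP ->; rewrite card_quotient.
  by rewrite order_dvdn -morphX //= coset_id.
have /b_dvd : b ^+ (j * p) \in K.
  by rewrite -(groupMr _ (mem_cycle k (i * (p * u)))) E.
rewrite -(ltn_predK n_gt2) expnSr dvdn_pmul2r // => /dvdnP[j' defj].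
have p_dvd_i : p %| i.
  move: E; rewrite defj -mulnA -expnSr (ltn_predK n_gt2) mulnC expgM bk -expgM.
  rewrite -expgD => /eqP; rewrite -order_dvdn ok.
  have -> : (p ^ 2 * j' + i * (p * u) = p * (p * j' + i * u))%N by ring.
  rewrite (expnS p 2) dvdn_pmul2l // => /(dvdn_trans (@dvdn_exp 2 p p isT (dvdnn p))).
  by rewrite (dvdn_addr _ (dvdn_mulr j' (dvdnn p))) Gauss_dvdl.
have Phi_x : x \in 'Phi(G).
  have MhoP y : y \in G -> y ^+ p \in 'Phi(G).
    move=> Gy; rewrite (Phi_joing pG) mem_gen // inE -[in y ^+ p](expn1 p).
    by rewrite Mho_p_elt ?orbT // (mem_p_elt pG).
  rewrite defx groupM //.
    have -> : j = ((j' * p ^ n.-2) * p)%N.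
      by rewrite -mulnA -expnSr defj; congr (_ * _ ^ _)%N; clear -n_gt2; lia.
    by rewrite expgM MhoP ?groupX.
  by case/dvdnP: p_dvd_i => i' ->; rewrite expgM MhoP ?groupX.
have : <<K1>> = G.
  apply: Phi_nongen; apply/eqP; rewrite eqEsubset join_subG Phi_sub sK1G /=.
  rewrite -{1}defGR join_subG joing_subr defR cycle_subG andbT.
  by rewrite (subsetP (joing_subl _ _)).
rewrite genGid => eqG; case/negP: ncG; rewrite -eqG cyclic_abelian //.
by case/metacyclic_structureP: str1.
Qed.

End Amalgam.

(** * The classification and the existence of each type *)

Lemma type_existsP p N t (gT : finGroupType) (G : {group gT}) :
    nonabelian_metacyclic_of_order G (p ^ N)%N -> of_type G t ->
  type_exists p N t.
Proof. by move=> ncG tG; exists gT, G; rewrite ncG tG. Qed.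

Lemma automatically_split_exists p N : prime p -> odd p ->
  4 <= N -> type_exists p N AutomaticallySplit.
Proof.
move=> p_pr p_odd N_ge4.
have n_ge2 : 1 < N - 2 by clear -N_ge4; lia.
have [|gT [G [k [s [defG ok os ks]]]]] :=
  exists_pgroup_semidirect p_pr p_odd (isT : 0 < 2) (ltnW n_ge2) (isT : 0 < 1).
  by rewrite ltnW.
have NE : N = (2 + (N - 2))%N by clear -N_ge4; lia.
have ncG := semidirect_nonabelian_metacyclic p_pr defG ok os ks _ NE.
apply: (type_existsP (ncG _)) => //.
exact: (semidirect_automatically_split p_pr p_odd defG ok os ks).
Qed.

(** The parameters of semidirect_purely_splittable with c = n must satisfy n <
    m <= 2 n and m + n = N; this has a solution unless N = 4, or N < 3, and
    then n = (N - 1) / 2 rounded down is one. *)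
Lemma purely_splittable_exists p N : prime p -> odd p ->
  N = 3 \/ 5 <= N -> type_exists p N PurelySplittable.
Proof.
move=> p_pr p_odd N_ok; pose n := (N.-1)./2; pose m := N - n.
have [n_gt0 lt_nm le_m NE] :
    [/\ 0 < n, n < m, m <= n + n & N = (m + n)%N].
  by rewrite /m /n; clear -N_ok; split; lia.
have [gT [G [k [s [defG ok os ks]]]]] :=
  exists_pgroup_semidirect p_pr p_odd (ltn_trans n_gt0 lt_nm) n_gt0 n_gt0 le_m.
have ncG := semidirect_nonabelian_metacyclic p_pr defG ok os ks _ NE.
apply: (type_existsP (ncG _)) => //.
exact: (semidirect_purely_splittable p_pr p_odd defG ok os ks).
Qed.

(** The modular group of order p^N. *)
Lemma mixed_type_exists p N : prime p -> odd p ->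
  4 <= N -> type_exists p N MixedType.
Proof.
move=> p_pr p_odd N_ge4.
have [m_gt2 c_gt0 le_m NE] :
    [/\ 2 < N.-1, 0 < N.-1.-1, N.-1 <= N.-1.-1 + 1 & N = (N.-1 + 1)%N].
  by clear -N_ge4; split; lia.
have [m_gt0 lt_cm] : 0 < N.-1 /\ N.-1.-1 < N.-1 by clear -m_gt2; lia.
have [gT [G [k [s [defG ok os ks]]]]] :=
  exists_pgroup_semidirect p_pr p_odd m_gt0 (isT : 0 < 1) c_gt0 le_m.
have ncG := semidirect_nonabelian_metacyclic p_pr defG ok os ks _ NE.
apply: (type_existsP (ncG _)) => //.
exact: (semidirect_mixed p_pr p_odd defG ok os ks).
Qed.

Lemma non_split_exists p N : prime p -> odd p ->
  6 <= N -> type_exists p N NonSplitMetacyclic.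
Proof.
move=> p_pr p_odd N_ge6.
have [n_gt2 NE] : 2 < N - 3 /\ N = (N - 3 + 3)%N by clear -N_ge6; lia.
have [gT [G [k [b [defG oG ok kb bk]]]]] := exists_amalgam p_pr p_odd n_gt2.
apply: (@type_existsP _ _ _ _ G).
  rewrite /nonabelian_metacyclic_of_order NE oG eqxx.
  rewrite (amalgam_nonabelian p_pr defG ok kb).
  exact: structure_metacyclic (amalgam_structure defG kb).
exact: (amalgam_non_split p_pr p_odd n_gt2 defG oG ok kb bk).
Qed.

Local Close Scope group_scope.

Theorem theorem1p3 (p : nat) (p_prime : prime p) (p_odd : odd p) :
  (forall (N : nat) (gT : finGroupType) (G : {group gT}),
     nonabelian_metacyclic_of_order G (p ^ N) ->
     (exists! t : metacyclic_type, of_type G t)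
     /\ (of_type G MixedType ->
         forall K : {group gT},
           metacyclic_structure G K -> splittable G K ->
           ~~ automatically_split G K))
  /\ (forall N : nat, 4 <= N -> type_exists p N AutomaticallySplit)
  /\ (forall N : nat, 6 <= N -> type_exists p N NonSplitMetacyclic)
  /\ (forall N : nat, N = 3 \/ 5 <= N -> type_exists p N PurelySplittable)
  /\ (forall N : nat, 4 <= N -> type_exists p N MixedType).
Proof.
split=> [N gT G /and3P[/eqP oG ncG mcG]|].
  have pG : (p.-group G)%g by rewrite /pgroup oG pnatX pnat_id.
  split; first exact: (unique_type p_prime pG ncG p_odd).
  move=> mixG K strK _.
  exact: (mixed_not_automatically_split p_prime pG ncG p_odd mixG strK).
split; first by move=> N; apply: automatically_split_exists.
split; first by move=> N; apply: non_split_exists.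
split; first by move=> N; apply: purely_splittable_exists.
by move=> N; apply: mixed_type_exists.
Qed.
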